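(* Let $N\ge3$, $n\ge1$, let $a_1,\dots,a_n\in\mathbb{R}^N$, and let $A$ be a positive definite real symmetric $N\times N$ matrix. Then for every $\varphi\in H^1_\mu$, $$\frac{c_o}{n}\int_{\mathbb{R}^N}\sum_{i=1}^n\frac{\varphi^2}{|x-a_i|^2}\,d\mu\le\int_{\mathbb{R}^N}|\nabla\varphi|^2\,d\mu+\frac n2\operatorname{Tr}A\int_{\mathbb{R}^N}\varphi^2\,d\mu,$$ where $c_o=\left(\frac{N-2}{2}\right)^2$.
   Context: $d\mu=\mu(x)\,dx$ with $\mu(x)=C\,e^{-\frac12\sum_{i=1}^n\langle A(x-a_i),x-a_i\rangle}$ and $C$ the normalizing constant making $\mu$ a probability density. $L^2_\mu=L^2(\mathbb{R}^N,d\mu)$. $H^1_\mu$ is the space of $f\in L^2_\mu$ with distributional gradient in $(L^2_\mu)^N$; equivalently the completion of $C_c^\infty(\mathbb{R}^N)$ in the norm $\|u\|_{H^1_\mu}^2=\|u\|^2_{L^2_\mu}+\|\nabla u\|^2_{L^2_\mu}$. *)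

(* Defs.v *)
From HB Require Import structures.
From mathcomp Require Import all_boot all_order all_algebra.
From mathcomp Require Import all_classical all_reals all_analysis.
Set Implicit Arguments. Unset Strict Implicit. Unset Printing Implicit Defensive.
Import Order.TTheory GRing.Theory Num.Theory.
Import numFieldNormedType.Exports.
Local Open Scope classical_set_scope.
Local Open Scope ring_scope.

Section Defs.
Variable R : realType.

(* Lebesgue integral over R^N of a nonnegative function, as the iterated
   integral dx_0 dx_1 ... dx_{N-1} (Tonelli) w.r.t. Lebesgue measure on R. *)
Fixpoint intRN (N : nat) : ('rV[R]_N -> \bar R) -> \bar R :=
  match N return ('rV[R]_N -> \bar R) -> \bar R with
  | 0 => fun f => f 0
  | N'.+1 => fun f =>
      (\int[@lebesgue_measure R]_(t in setT)
          intRN (fun y : 'rV[R]_N' => f (row_mx (const_mx t : 'rV[R]_1) y)))%E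
  end.

Definition sqnorm (N : nat) (v : 'rV[R]_N) : R := \sum_(i < N) (v ord0 i) ^+ 2.

Definition partial (N : nat) (i : 'I_N) (f : 'rV[R]_N -> R) : 'rV[R]_N -> R :=
  fun x => 'D_(delta_mx ord0 i) f x.

Definition grad (N : nat) (f : 'rV[R]_N -> R) (x : 'rV[R]_N) : 'rV[R]_N :=
  \row_(i < N) partial i f x.

Fixpoint Ck (N : nat) (k : nat) (f : 'rV[R]_N -> R) : Prop :=
  match k with
  | 0 => continuous f
  | k'.+1 => (forall x, differentiable f x) /\ (forall i : 'I_N, Ck k' (partial i f))
  end.

Definition smooth (N : nat) (f : 'rV[R]_N -> R) : Prop := forall k, Ck k f.

Definition compact_support (N : nat) (f : 'rV[R]_N -> R) : Prop :=
  exists r : R, forall x, r < sqnorm x -> f x = 0.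

Definition Cc_infty (N : nat) (f : 'rV[R]_N -> R) : Prop :=
  smooth f /\ compact_support f.

Definition borelRN (N : nat) : set (set 'rV[R]_N) :=
  <<s [set U | open U] >>.

Definition borel_fun (N : nat) (f : 'rV[R]_N -> R) : Prop :=
  forall B : set R, measurable B -> borelRN (f @^-1` B).

Definition qform (N : nat) (A : 'M[R]_N) (v : 'rV[R]_N) : R :=
  (v *m A *m v^T) ord0 ord0.

Definition pos_def_sym (N : nat) (A : 'M[R]_N) : Prop :=
  A^T = A /\ forall v : 'rV[R]_N, v != 0 -> 0 < qform A v.

Definition gauss_unnorm (N n : nat) (A : 'M[R]_N) (a : 'I_n -> 'rV[R]_N)
    (x : 'rV[R]_N) : R :=
  expR (- (1/2) * \sum_(i < n) qform A (x - a i)).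

Definition mu_dens (N n : nat) (A : 'M[R]_N) (a : 'I_n -> 'rV[R]_N)
    (x : 'rV[R]_N) : R :=
  gauss_unnorm A a x / fine (intRN (fun y => (gauss_unnorm A a y)%:E)).

(* phi in H^1_mu, with weak gradient g: phi is the limit in H^1_mu of a
   sequence of C_c^infty functions (completion definition). *)
Definition H1mu_with_grad (N n : nat) (A : 'M[R]_N) (a : 'I_n -> 'rV[R]_N)
    (phi : 'rV[R]_N -> R) (g : 'rV[R]_N -> 'rV[R]_N) : Prop :=
  borel_fun phi /\ (forall j : 'I_N, borel_fun (fun x => g x ord0 j)) /\
  exists u : nat -> 'rV[R]_N -> R,
    (forall k, Cc_infty (u k)) /\
    ((fun k => intRN (fun x => ((u k x - phi x) ^+ 2 * mu_dens A a x)%:E))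
       @ \oo --> 0%E) /\
    ((fun k => intRN (fun x => (sqnorm (grad (u k) x - g x) * mu_dens A a x)%:E))
       @ \oo --> 0%E).

End Defs.

(* Main.v *)
(** For u smooth with compact support and a smooth vector field W,
      0 <= |grad u + u W|^2 rho
         = |grad u|^2 rho + u^2 |W|^2 rho - u^2 div (W rho) + div (u^2 W rho),
    and the last term integrates to 0.  Write rho = exp (- V), beta = (N-2)/2 and
    take W = beta (x - b) / (|x - b|^2 + e) - grad V / 2: the cross terms cancel
    and, since Delta V = n tr A,
      beta^2 u^2 / (|x - b|^2 + e) rho
        <= |grad u|^2 rho + (n/2) tr A u^2 rho + div (u^2 W rho).
    With e > 0 the weight is bounded, so the integrated inequality passes from
    u_k to phi by phi^2 <= (1+t) u_k^2 + (1+1/t) (u_k - phi)^2; then e -> 0 by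
    monotone convergence, and averaging over the poles b = a_i gives the
    factor 1/n.

    The iterated integral [intRN] is handled by identifying it with the integral
    against an honest sigma-finite measure on the Borel sets of R^N, built by
    pushing forward the product of two measures along [row_mx]. *)

Require Import Defs.
From HB Require Import structures.
From mathcomp Require Import all_boot all_order all_algebra.
From mathcomp Require Import all_classical all_reals all_analysis.
From mathcomp Require Import measurable_realfun ring lra.
Import Order.TTheory GRing.Theory Num.Theory.
Import numFieldNormedType.Exports.
Local Open Scope classical_set_scope.
Local Open Scope ring_scope.
Set Implicit Arguments. Unset Strict Implicit. Unset Printing Implicit Defensive.

(** * The measure space R^N *)

Section Borel.
Variable R : realType.

(** An alias of the row vectors that carries the Borel sigma-algebra; topology and derivatives stay
    on ['rV[R]_N], hence the casts between the two. *)
Definition RN (N : nat) := g_sigma_algebraType [set U : set 'rV[R]_N | open U].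

Lemma open_borel N (U : set 'rV[R]_N) : open U -> measurable (U : set (RN N)).
Proof. by move=> oU; exact: sub_gen_smallest. Qed.

Lemma borel_fun_measurable N (f : 'rV[R]_N -> R) :
  borel_fun f -> measurable_fun setT (f : RN N -> R).
Proof. by move=> bf _ B mB; rewrite setTI; exact: bf. Qed.

Lemma continuous_borel N (f : 'rV[R]_N -> R) :
  continuous f -> measurable_fun setT (f : RN N -> R).
Proof.
move=> /continuousP cf; apply: (measurability _ (RGenOpens.measurableE R)).
move=> _ [_ [a [b ->]] <-]; rewrite setTI; apply: open_borel.
by apply: cf; exact: interval_open.
Qed.

Definition cons_rV N (z : R * RN N) : RN N.+1 :=
  row_mx (const_mx z.1 : 'rV[R]_1) z.2.

Lemma cons_rV0 N (z : R * RN N) : (cons_rV z : 'rV_N.+1) ord0 ord0 = z.1.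
Proof.
rewrite /cons_rV; have -> : ord0 = lshift N (ord0 : 'I_1) by exact: val_inj.
by apply: (etrans (row_mxEl _ _ _ _)); rewrite mxE.
Qed.

Lemma cons_rVS N (z : R * RN N) (j : 'I_N) :
  (cons_rV z : 'rV_N.+1) ord0 (lift ord0 j) = (z.2 : 'rV_N) ord0 j.
Proof.
rewrite /cons_rV; have -> : lift ord0 j = rshift 1 j by exact: val_inj.
exact: row_mxEr.
Qed.

Lemma rat_approx (x e : R) : 0 < e -> exists q : rat, `|ratr q - x| < e.
Proof.
move=> e0; have /rat_in_itvoo[q] : x - e < x + e.
  by rewrite ltrBlDr -addrA ltrDl addr_gt0.
by rewrite in_itv/= -ltr_distl => qxe; exists q.
Qed.

(** Balls of the sup norm indexed by a countable type: a countable base of the topology. *)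
Definition rat_ball N (i : 'rV[rat]_N * nat) : set 'rV[R]_N :=
  ball (map_mx (@ratr R) i.1 : 'rV[R]_N) (i.2.+1%:R^-1 : R).

(** Second countability. Balls not contained in [U] are replaced by [set0], so that the union runs
    over the whole countable index type. *)
Lemma open_rat_balls N (U : set 'rV[R]_N) : open U ->
  U = \bigcup_i (if `[< rat_ball i `<=` U >] then rat_ball i else set0).
Proof.
move=> oU; apply/seteqP; split => [x Ux|x [i _]]; last first.
  by case: asboolP => // iU /iU.
have /nbhs_ballP[e /= e0 eU] : nbhs x U by exact: open_nbhs_nbhs.
(* With radius below [e / 2], a rational ball that contains [x] lies in the [e]-ball around [x]. *)
have [k ke] : exists k : nat, k.+1%:R^-1 < e / 2.
  have e20 : 0 < e / 2 by rewrite divr_gt0.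
  have [k _ /(_ k (leqnn k)) ke] := near_infty_natSinv_lt (PosNum e20).
  by exists k.
have k0 : 0 < k.+1%:R^-1 :> R by rewrite invr_gt0.
pose q j := xchoose (rat_approx (x ord0 j) k0).
have qx j : `|ratr (q j) - x ord0 j| < k.+1%:R^-1.
  by exact: (xchooseP (rat_approx (x ord0 j) k0)).
have qbx : rat_ball (\row_j q j, k) x.
  by split=> // i j; rewrite !mxE (ord1 i); exact: qx.
exists (\row_j q j, k) => //; case: asboolP => // -[].

move=> y qy; apply: eU.
apply: (@ball_splitr _ _ (map_mx (@ratr R) (\row_j q j))).
  exact: (le_ball (ltW ke)) qbx.
exact: (le_ball (ltW ke)) qy.
Qed.

(** A sup-norm ball is the product of an interval and a ball one dimension lower, so rational balls
    pull back to measurable rectangles and open sets to countable unions of these. *)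
Lemma measurable_cons_rV N : measurable_fun setT (@cons_rV N).
Proof.
apply: (@measurability _ _ _ (RN N.+1) _ _
  [set U : set 'rV[R]_N.+1 | open U] erefl).
move=> _ [U /= oU <-]; rewrite setTI (open_rat_balls oU) preimage_bigcup.
apply: countable_bigcupT_measurable => // i.
case: asboolP => _; last by rewrite preimage_set0.
have -> : @cons_rV N @^-1` (rat_ball i) =
    (ball (ratr (i.1 ord0 ord0) : R) (i.2.+1%:R^-1 : R)) `*`
    (rat_ball (\row_j i.1 ord0 (lift ord0 j), i.2) : set (RN N)).
  apply/seteqP; split => [[t y] [e0 ib]|[t y] [/= ib1 [e0 ib2]]].
    split=> /=.
      by have := ib ord0 ord0; rewrite cons_rV0 mxE.
    split=> // k j; have := ib ord0 (lift ord0 j).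
    by rewrite cons_rVS !mxE (ord1 k).
  split => // k j; rewrite (ord1 k); case: (unliftP ord0 j) => [j'|] ->.
    by have := ib2 ord0 j'; rewrite cons_rVS !mxE.
  by rewrite cons_rV0 mxE.
apply: measurableX; first exact: measurable_ball.
by apply: open_borel; rewrite /rat_ball; exact: ball_open.
Qed.

End Borel.

(** * Compact boxes, and the product measure in one more dimension *)

Section Measure.
Variable R : realType.

Definition box N (M : R) : set 'rV[R]_N :=
  [set v | forall j, `[- M, M]%classic (v ord0 j)].

Lemma compact_box N (M : R) : compact (@box N M).
Proof.
by apply: (@rV_compact _ N (fun=> `[- M, M]%classic)) => j; exact: segment_compact.
Qed.

Lemma measurable_box N (M : R) : measurable (@box N M : set (RN R N)).
Proof.
rewrite -[X in measurable X]setCK; apply: measurableC; apply: open_borel.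
apply: closed_openC; apply: compact_closed; last exact: compact_box.
exact: norm_hausdorff.
Qed.

Lemma cons_rV_box N (M : R) :
  @cons_rV R N @^-1` (@box N.+1 M) = `[- M, M]%classic `*` @box N M.
Proof.
apply/seteqP; split => [[t y] b|[t y] [/= b1 b2] j].
  split=> /=; first by have := b ord0; rewrite cons_rV0.
  by move=> j; have := b (lift ord0 j); rewrite cons_rVS.
case: (unliftP ord0 j) => [j'|] ->; first by rewrite cons_rVS; exact: b2.
by rewrite cons_rV0.
Qed.

Lemma bigcup_box N : \bigcup_k @box N k%:R = setT.
Proof.
apply/seteqP; split => // x _.
exists (Num.trunc (\sum_j `|x ord0 j|)).+1 => // j /=.
rewrite in_itv/= -ler_norml ltW//; apply: le_lt_trans (truncnS_gt _).
by rewrite (bigD1 j)//= lerDl sumr_ge0.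
Qed.

Lemma continuous_box_bounded N (f : 'rV[R]_N -> R) (M : R) : continuous f ->
  exists2 C : R, 0 <= C & forall x, box M x -> `|f x| <= C.
Proof.
move=> cf; have /compact_bounded[C [_ Cf]] : compact (f @` box M).
  by apply: continuous_compact; [exact: continuous_subspaceT|exact: compact_box].
exists (`|C| + 1); first by rewrite addr_ge0.
move=> x Mx; apply: Cf; last by exists x.
by rewrite (le_lt_trans (ler_norm _))// ltrDl.
Qed.

(** Stated one coordinate at a time, so that it passes to slices in which some coordinates are
    frozen. *)
Definition box_supported N (M : R) (f : 'rV[R]_N -> R) :=
  forall (x : 'rV[R]_N) j, M < `|x ord0 j| -> f x = 0.

Lemma box_supportedN N M (f : 'rV[R]_N -> R) x :
  box_supported M f -> ~ box M x -> f x = 0.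
Proof.
move=> fM nMx; have [j] : exists j, M < `|x ord0 j|.
  apply: contrapT => /forallNP nj; apply: nMx => j /=.
  by rewrite in_itv/= -ler_norml leNgt; apply/negP/nj.
exact: fM.
Qed.

(** Such a function is bounded on the compact box, hence dominated by a multiple of the indicator of
    a set of finite measure. *)
Lemma continuous_supported_integrable N (l : {measure set RN R N -> \bar R})
    (f : 'rV[R]_N -> R) (M : R) :
  (l (box M) < +oo)%E -> continuous f -> box_supported M f ->
  l.-integrable setT (EFin \o f).
Proof.
move=> lM cf fM; have [C C0 fC] := continuous_box_bounded M cf.
have mf : measurable_fun setT (EFin \o f : RN R N -> \bar R).
  by apply/measurable_EFinP; exact: continuous_borel.
apply: (@le_integrable _ _ _ l setT measurableT _
  (fun x => (C * \1_(@box N M) x)%:E)) => //.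
  move=> x _ /=; rewrite lee_fin normrM (ger0_norm C0) indicE.
  have [Mx|Mx] := pselect (box M x).
    by rewrite mem_set// normr1 mulr1; exact: fC.
  by rewrite memNset// (box_supportedN fM)// !normr0 mulr0.
apply/integrableP; split.
  apply/measurable_EFinP; apply: measurable_funM; first exact: measurable_cst.
  apply: measurable_indic; exact: measurable_box.
rewrite (eq_integral (fun x : RN R N => (C%:E * (\1_(@box N M) x)%:E)%E)); last first.
  by move=> x _; rewrite gee0_abs ?EFinM// mule_ge0 ?lee_fin.
rewrite ge0_integralZl//=.
- rewrite integral_indic//; last exact: measurable_box.
  by rewrite setIT lte_mul_pinfty ?lee_fin.
- by apply/measurable_EFinP; apply: measurable_indic; exact: measurable_box.
Qed.

Section Cons.
Variable N : nat.
Variable l : {sigma_finite_measure set RN R N -> \bar R}.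
Hypothesis lbox : forall M, (l (box M) < +oo)%E.

(** Prepending a coordinate mirrors the recursion of [intRN], whose outermost integral is over the
    first coordinate. *)
Definition cons_measure : set (RN R N.+1) -> \bar R :=
  pushforward (@lebesgue_measure R \x l)%E (@cons_rV R N).

HB.instance Definition _ := Measure.copy cons_measure
  (measure_function_pushforward__canonical__measure_function_Measure
     (@lebesgue_measure R \x l)%E (@measurable_cons_rV R N)).

Lemma cons_measure_box M : (cons_measure (box M) < +oo)%E.
Proof.
rewrite /cons_measure /pushforward cons_rV_box product_measure1E//; last first.
  exact: measurable_box.
apply: lte_mul_pinfty => //.
by rewrite /= lebesgue_measure_itv; case: ifP => //; rewrite -EFinD.
Qed.

Lemma cons_measure_sigma_finite : sigma_finite setT cons_measure.
Proof.
exists (fun k => box k%:R); first by rewrite bigcup_box.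
by move=> k; split; [exact: measurable_box|exact: cons_measure_box].
Qed.

Lemma ge0_integral_cons (f : RN R N.+1 -> \bar R) :
  measurable_fun setT f -> (forall x, 0 <= f x)%E ->
  (\int[cons_measure]_x f x =
   \int[@lebesgue_measure R]_t \int[l]_y f (cons_rV (t, y)))%E.
Proof.
move=> mf f0; rewrite ge0_integral_pushforward//; last exact: measurable_cons_rV.
rewrite preimage_setT fubini_tonelli1//.
- by apply: measurableT_comp => //; exact: measurable_cons_rV.
- by move=> z; exact: f0.
Qed.

Lemma integrable_cons (f : RN R N.+1 -> \bar R) :
  cons_measure.-integrable setT f ->
  (@lebesgue_measure R \x l)%E.-integrable setT (f \o @cons_rV R N).
Proof.
move=> /integrableP[mf foo]; apply/integrableP; split.
  by apply: measurableT_comp => //; exact: measurable_cons_rV.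
move: foo; rewrite ge0_integral_pushforward//; first exact: measurable_cons_rV.
exact: measurableT_comp.
Qed.

(** Both orders of Fubini are needed: the variable being differentiated has to be integrated
    first. *)
Lemma integral_cons1 (f : RN R N.+1 -> \bar R) :
  cons_measure.-integrable setT f ->
  (\int[cons_measure]_x f x =
   \int[@lebesgue_measure R]_t \int[l]_y f (cons_rV (t, y)))%E.
Proof.
move=> fi; have fci := integrable_cons fi; have /integrableP[mf _] := fi.
rewrite integral_pushforward//; last exact: measurable_cons_rV.
by rewrite preimage_setT -integral12_prod_meas1.
Qed.

Lemma integral_cons2 (f : RN R N.+1 -> \bar R) :
  cons_measure.-integrable setT f ->
  (\int[cons_measure]_x f x =
   \int[l]_y \int[@lebesgue_measure R]_t f (cons_rV (t, y)))%E.
Proof.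
move=> fi; have fci := integrable_cons fi; have /integrableP[mf _] := fi.
rewrite integral_pushforward//; last exact: measurable_cons_rV.
by rewrite preimage_setT -integral21_prod_meas1.
Qed.

End Cons.

End Measure.

(** * Integration by parts *)

Section Divergence.
Variable R : realType.

(** A directional derivative sees only the restriction to a line. This carries derivatives from
    [R^N] to its slices, and reduces those of explicit functions to one real variable. *)
Lemma is_derive_line (V V' : normedModType R) (f : V -> R) (g : V' -> R)
    a v b w d :
  (forall k, g (k *: w + b) = f (k *: v + a)) ->
  is_derive a v f d -> is_derive b w g d.
Proof.
move=> gf [fd fv].
have gfq : (fun k => k^-1 *: ((g \o shift b) (k *: w) - g b)) =
           (fun k => k^-1 *: ((f \o shift a) (k *: v) - f a)).
  apply/funext => k /=; rewrite gf.
  by have := gf 0; rewrite !scale0r !add0r => ->.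
split; first by rewrite /derivable gfq.
by rewrite /derive gfq.
Qed.

(** By continuity of [p] the condition [M < |p|] persists near [x], where [f] is therefore
    constantly zero. *)
Lemma is_derive_vanish (V : normedModType R) (f p : V -> R) (M d : R) x v :
  (forall y, M < `|p y| -> f y = 0) -> {for x, continuous p} ->
  M < `|p x| -> is_derive x v f d -> d = 0.
Proof.
move=> fM px Mx [_ <-]; rewrite (@near_eq_derive _ _ _ f (cst 0)) ?derive_cst//.
have Mp : \forall y \near x, M < `|p y|.
  by apply: (cvgr_gt `|p x|) => //; exact: cvg_norm.
by apply: filterS Mp => y /fM ->.
Qed.

Lemma is_derive_box_supported N (M : R) (i : 'I_N) (f h : 'rV[R]_N -> R) :
  (forall x, is_derive x (delta_mx ord0 i) f (h x)) ->
  box_supported M f -> box_supported M h.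
Proof.
move=> fh fM x j Mx.
apply: (@is_derive_vanish _ f (fun y => y ord0 j) M) (fh x) => //.
  by move=> y; exact: fM.
exact: coord_continuous.
Qed.

Lemma integral_is_derive1 (M : R) (f h : R -> R) :
  (forall t : R, is_derive t (1 : R) f (h t)) -> continuous h ->
  (forall t, M < `|t| -> f t = 0) ->
  (\int[@lebesgue_measure R]_t (h t)%:E = 0)%E.
Proof.
move=> fh ch fM.
(* [M] may be negative; this [K] is positive and exceeds [M], so [f] vanishes at both ends of the
   interval [[-K, K]]. *)
pose K := `|M| + 1.
have K0 : 0 < K by rewrite ltr_wpDl.
have MK : M < K by rewrite (le_lt_trans (ler_norm _))// ltrDl.
have hM t : M < `|t| -> h t = 0.
  by move=> Mt; apply: (@is_derive_vanish _ f id M) (fh t) => //; exact: cvg_id.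
have -> : (\int[@lebesgue_measure R]_t (h t)%:E =
    \int[@lebesgue_measure R]_(t in `[(- K)%R, K]) (h t)%:E)%E.
  rewrite [RHS]integral_mkcond; apply: eq_integral => t _.
  rewrite patchE; case: ifPn => //; rewrite notin_setE/= in_itv/= -ler_norml.
  by move=> /negP; rewrite -ltNge => Kt; rewrite hM// (lt_trans MK).
have fc : continuous f.
  move=> t; apply: differentiable_continuous; apply/derivable1_diffP.
  by have [] := fh t.
rewrite (@continuous_FTC2 _ h f).
- by rewrite !fM ?subee// ?normrN gtr0_norm.
- by rewrite -subr_gt0 opprK addr_gt0.
- exact: continuous_subspaceT.
- split.
  + by move=> t _; have [] := fh t.
  + by apply: cvg_at_right_filter; exact: fc.
  + by apply: cvg_at_left_filter; exact: fc.
- by move=> t _; rewrite derive1E; have [_ ->] := fh t.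
Qed.

(** The divergence theorem without boundary term, one coordinate at a time; it is the only property
    of Lebesgue measure, besides finiteness on boxes, that the Hardy estimate uses. *)
Definition div_free N (l : set (RN R N) -> \bar R) :=
  forall (i : 'I_N) (M : R) (f h : 'rV[R]_N -> R),
    (forall x, is_derive x (delta_mx ord0 i) f (h x)) -> continuous h ->
    box_supported M f -> (\int[l]_x (h x)%:E = 0)%E.

Lemma cons_rV_continuousl N (y : 'rV[R]_N) :
  continuous (fun t : R => cons_rV (t, y : RN R N) : 'rV[R]_N.+1).
Proof.
move=> t A /nbhs_ballP[e /= e0 eA]; apply/nbhs_ballP; exists e => //= s ts.
apply: eA; split=> // k j; rewrite (ord1 k).
case: (unliftP ord0 j) => [j'|] ->; first by rewrite !cons_rVS; exact: ballxx.
by rewrite !cons_rV0.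
Qed.

Lemma cons_rV_continuousr N (t : R) :
  continuous (fun y : 'rV[R]_N => cons_rV (t, y : RN R N) : 'rV[R]_N.+1).
Proof.
move=> y A /nbhs_ballP[e /= e0 eA]; apply/nbhs_ballP; exists e => //= z [_ yz].
apply: eA; split=> // k j; rewrite (ord1 k).
case: (unliftP ord0 j) => [j'|] ->; first by rewrite !cons_rVS; exact: yz.
by rewrite !cons_rV0/=; exact: ballxx.
Qed.

Lemma cons_rV_line0 N k (t : R) (y : RN R N) :
  (k *: delta_mx ord0 ord0 + cons_rV (t, y) : 'rV[R]_N.+1) =
  cons_rV (k *: 1 + t, y).
Proof.
apply/rowP => j; rewrite mxE [X in X + _]mxE [X in _ * X]mxE.
case: (unliftP ord0 j) => [j'|] ->; first by rewrite !cons_rVS/= mulr0 add0r.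
by rewrite !cons_rV0.
Qed.

Lemma cons_rV_lineS N k (t : R) (y : 'rV[R]_N) i :
  (k *: delta_mx ord0 (lift ord0 i) + cons_rV (t, y : RN R N) : 'rV[R]_N.+1) =
  cons_rV (t, (k *: delta_mx ord0 i + y : 'rV[R]_N) : RN R N).
Proof.
apply/rowP => j; rewrite mxE [X in X + _]mxE [X in _ * X]mxE.
case: (unliftP ord0 j) => [j'|] ->; last by rewrite !cons_rV0/= mulr0 add0r.
by rewrite !cons_rVS/= !mxE (inj_eq lift_inj).
Qed.

(** In the new coordinate the inner integral vanishes by the fundamental theorem of calculus; in an
    old one it vanishes by the hypothesis on [l] applied to the slice. *)
Lemma cons_measure_div_free N (l : {sigma_finite_measure set RN R N -> \bar R}) :
  (forall M, l (box M) < +oo)%E -> div_free l -> div_free (cons_measure l).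
Proof.
move=> lM ld i M f h fh ch fM.
have hi : (cons_measure l).-integrable setT (EFin \o h).
  apply: continuous_supported_integrable => //; first exact: (cons_measure_box lM).
  exact: is_derive_box_supported fh fM.
case: (unliftP ord0 i) => [i'|] ii; last first.
  rewrite integral_cons2//; apply: integral0_eq => y _ /=.
  apply: (@integral_is_derive1 M (fun t => f (cons_rV (t, y)))).
  - move=> t; apply: is_derive_line (fh (cons_rV (t, y))) => k.
    by rewrite ii cons_rV_line0.
  - move=> t; apply: continuous_comp; [exact: cons_rV_continuousl|exact: ch].
  - by move=> t Mt; apply: (fM _ ord0); rewrite cons_rV0.
rewrite integral_cons1//; apply: integral0_eq => t _ /=.
apply: (ld i' M (fun y => f (cons_rV (t, y : RN R N)))).
- move=> y; apply: is_derive_line (fh (cons_rV (t, y))) => k.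
  by rewrite ii cons_rV_lineS.
- move=> y; apply: continuous_comp; [exact: cons_rV_continuousr|exact: ch].
- by move=> y j Mt; apply: (fM _ (lift ord0 j)); rewrite cons_rVS.
Qed.

Lemma lebesgue_RN N : exists l : {sigma_finite_measure set RN R N -> \bar R},
  [/\ forall f : RN R N -> \bar R, measurable_fun setT f ->
        (forall x, 0 <= f x)%E -> intRN f = (\int[l]_x f x)%E,
      forall M, (l (box M) < +oo)%E &
      div_free l].
Proof.
elim: N => [|N [l [lE lM ld]]].
  (* [R^0] is a single point, and [div_free] is vacuous there because ['I_0] is empty. *)
  exists (dirac (0 : RN R 0)); split => [f mf f0|M|[]//].
    by rewrite integral_dirac// diracT mul1e.
  by rewrite /= diracE ltry.
pose s : {sigma_finite_measure set RN R N.+1 -> \bar R} :=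
  HB.pack (cons_measure l) (Measure.on (cons_measure l))
    (Measure_isSigmaFinite.Build _ _ _ (cons_measure l)
       (cons_measure_sigma_finite lM)).
exists s; split.
- move=> f mf f0; rewrite ge0_integral_cons//=; apply: eq_integral => t _.
  apply: lE => [|y]; last exact: f0.
  exact: (measurableT_comp mf
    (measurableT_comp (@measurable_cons_rV R N) (pair1_measurable t))).
- exact: (cons_measure_box lM).
- exact: (cons_measure_div_free lM).
Qed.

End Divergence.

(** * The inequality for smooth functions *)

Section Calculus.
Variable R : realType.

(** Along a coordinate line, every explicit function below is a quadratic polynomial in [t], or the
    exponential or the inverse of one; these three cases suffice. *)
Lemma is_derive_quadratic (c0 c1 c2 : R) :
  is_derive (0 : R) (1 : R) (fun t => c0 + t * c1 + t ^+ 2 * c2) c1.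
Proof.
have dc (c : R) := is_derive_cst c (0 : R) (1 : R).
have did := is_derive_id (0 : R) (1 : R).
have := is_deriveD (is_deriveD (dc c0) (is_deriveM did (dc c1)))
  (is_deriveM (is_deriveX 2 did) (dc c2)).
move/is_derive_eq; apply.
by rewrite /= !scaler0 expr1 mulr0 scale0r scaler0 !add0r addr0 [_ *: _]mulr1.
Qed.

Lemma is_derive_expR_quadratic (c0 c1 c2 : R) :
  is_derive (0 : R) (1 : R) (fun t => expR (c0 + t * c1 + t ^+ 2 * c2))
    (expR c0 * c1).
Proof.
have := is_derive1_comp (is_derive_expR _) (is_derive_quadratic c0 c1 c2).
by move/is_derive_eq; apply; rewrite mul0r expr0n mul0r !addr0.
Qed.

Lemma is_derive_inv_quadratic (c0 c1 c2 : R) : c0 != 0 ->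
  is_derive (0 : R) (1 : R) (fun t => (c0 + t * c1 + t ^+ 2 * c2)^-1)
    (- c1 / c0 ^+ 2).
Proof.
move=> c00.
have := @is_deriveV _ _ 0 _ _ _ (is_derive_quadratic c0 c1 c2).
rewrite mul0r expr0n mul0r !addr0 => /(_ c00) /is_derive_eq; apply.
by rewrite [_ *: _]mulrC mulrN mulNr.
Qed.

Section Continuity.
Variable T : topologicalType.
Implicit Types f g : T -> R.

Lemma continuous_fun_add f g : continuous f -> continuous g ->
  continuous (fun x => f x + g x).
Proof. by move=> cf cg x; apply: cvgD; [exact: cf|exact: cg]. Qed.

Lemma continuous_fun_mul f g : continuous f -> continuous g ->
  continuous (fun x => f x * g x).
Proof. by move=> cf cg x; apply: cvgM; [exact: cf|exact: cg]. Qed.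

Lemma continuous_fun_inv f : (forall x, f x != 0) -> continuous f ->
  continuous (fun x => (f x)^-1).
Proof. by move=> f0 cf x; apply: cvgV; [exact: f0|exact: cf]. Qed.

Lemma continuous_fun_sum (I : Type) (r : seq I) (F : I -> T -> R) :
  (forall i, continuous (F i)) -> continuous (fun x => \sum_(i <- r) F i x).
Proof. by move=> cF; apply: continuous_big => //; exact: add_continuous. Qed.

Lemma continuous_fun_cst (c : R) : continuous (fun _ : T => c).
Proof. by move=> x; exact: cvg_cst. Qed.

End Continuity.

Variables (N n : nat) (A : 'M[R]_N) (a : 'I_n -> 'rV[R]_N).
Hypothesis Asym : A^T = A.

(** For symmetric [A], the [i]-th component of the gradient of [V], where [gauss_unnorm] is
    [exp (- V)]. *)
Definition dpot (i : 'I_N) (x : 'rV[R]_N) : R :=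
  \sum_(k < n) ((x - a k) *m A) ord0 i.

Lemma continuous_coordB (b : 'rV[R]_N) i :
  continuous (fun x : 'rV[R]_N => (x - b) ord0 i).
Proof.
rewrite (_ : (fun x => _) = fun x : 'rV[R]_N => x ord0 i + - b ord0 i).
  apply: continuous_fun_add; first exact: coord_continuous.
  exact: continuous_fun_cst.
by apply/funext => x; rewrite !mxE.
Qed.

Lemma continuous_mulmxB (b : 'rV[R]_N) i :
  continuous (fun x : 'rV[R]_N => ((x - b) *m A) ord0 i).
Proof.
under eq_fun do rewrite mxE.
apply: continuous_fun_sum => j; apply: continuous_fun_mul.
  exact: continuous_coordB.
exact: continuous_fun_cst.
Qed.

Lemma continuous_dpot i : continuous (dpot i).
Proof. by apply: continuous_fun_sum => k; exact: continuous_mulmxB. Qed.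

Lemma continuous_sqnormB (b : 'rV[R]_N) :
  continuous (fun x : 'rV[R]_N => sqnorm (x - b)).
Proof.
apply: continuous_fun_sum => j.
by apply: continuous_fun_mul; exact: continuous_coordB.
Qed.

Lemma continuous_gauss : continuous (gauss_unnorm A a).
Proof.
move=> x; apply: continuous_comp; last exact: continuous_expR.
move: x; apply: continuous_fun_mul; first exact: continuous_fun_cst.
apply: continuous_fun_sum => k; rewrite /qform.
under eq_fun do rewrite mxE.
apply: continuous_fun_sum => j; apply: continuous_fun_mul.
  exact: continuous_mulmxB.
by under eq_fun do rewrite mxE; exact: continuous_coordB.
Qed.

Lemma sqnorm_ge0 (v : 'rV[R]_N) : 0 <= sqnorm v.
Proof. by apply: sumr_ge0 => i _; rewrite sqr_ge0. Qed.

Lemma mulmx_delta_entry (B : 'M[R]_N) (v : 'rV[R]_N) i :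
  (v *m B *m (delta_mx (ord0 : 'I_1) i)^T) ord0 ord0 = (v *m B) ord0 i.
Proof. by rewrite trmx_delta -colE mxE. Qed.

Lemma qform_line (v : 'rV[R]_N) (t : R) i :
  qform A (t *: delta_mx ord0 i + v) =
  qform A v + t * (2 * (v *m A) ord0 i) + t ^+ 2 * A i i.
Proof.
rewrite /qform linearD/= linearZ/= !mulmxDl !mulmxDr -!scalemxAl -!scalemxAr.
(* A 1 by 1 matrix equals its transpose; as [A] is symmetric, the two cross terms coincide. *)
have e1 : (delta_mx (ord0 : 'I_1) i *m A *m v^T) ord0 ord0 = (v *m A) ord0 i.
  rewrite -mulmx_delta_entry
    -[LHS](_ : (delta_mx (ord0 : 'I_1) i *m A *m v^T)^T ord0 ord0 = _).
    by rewrite !trmx_mul trmxK Asym mulmxA.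
  by rewrite mxE.
have e2 : (delta_mx (ord0 : 'I_1) i *m A *m (delta_mx (ord0 : 'I_1) i)^T)
    ord0 ord0 = A i i.
  by rewrite mulmx_delta_entry -rowE mxE.
have e3 := mulmx_delta_entry A v i.
have D (P Q : 'M[R]_1) : (P + Q) ord0 ord0 = P ord0 ord0 + Q ord0 ord0.
  by rewrite mxE.
have Z k (P : 'M[R]_1) : (k *: P) ord0 ord0 = k * P ord0 ord0 by rewrite mxE.
rewrite !(D, Z) e1 e2 e3; ring.
Qed.

Lemma sqnorm_line (v : 'rV[R]_N) (t : R) i :
  sqnorm (t *: delta_mx ord0 i + v) =
  sqnorm v + t * (2 * v ord0 i) + t ^+ 2.
Proof.
rewrite /sqnorm (bigD1 i)//= [in RHS](bigD1 i)//= !mxE !eqxx.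
rewrite (eq_bigr (fun j => v ord0 j ^+ 2)); first by rewrite /=; ring.
by move=> j ji; rewrite !mxE (negbTE ji) andbF mulr0 add0r.
Qed.

Lemma is_derive_gauss i x :
  is_derive x (delta_mx ord0 i) (gauss_unnorm A a)
    (- dpot i x * gauss_unnorm A a x).
Proof.
have d := is_derive_expR_quadratic (- (1/2) * \sum_(k < n) qform A (x - a k))
  (- dpot i x) (- (1/2) * (n%:R * A i i)).
rewrite mulrC; apply: is_derive_line d => k; congr expR.
rewrite addr0 [k *: 1]mulr1.
rewrite (eq_bigr (fun j => qform A (x - a j) +
    k * (2 * ((x - a j) *m A) ord0 i) + k ^+ 2 * A i i)); last first.
  by move=> j _; rewrite -addrA qform_line.
rewrite !big_split/= -!mulr_sumr sumr_const card_ord -mulr_natl -/(dpot i x).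
by field.
Qed.

Lemma is_derive_inv_sqnorm (b : 'rV[R]_N) (e : R) i x : 0 < e ->
  is_derive x (delta_mx ord0 i) (fun y => (sqnorm (y - b) + e)^-1)
    (- (2 * (x - b) ord0 i) / (sqnorm (x - b) + e) ^+ 2).
Proof.
move=> e0.
have d := @is_derive_inv_quadratic (sqnorm (x - b) + e) (2 * (x - b) ord0 i) 1 _.
apply: is_derive_line (d _); last by rewrite gt_eqF// ltr_wpDl// sqnorm_ge0.
move=> k; congr (_ ^-1); rewrite -addrA sqnorm_line addr0 [k *: 1]mulr1; ring.
Qed.

Lemma is_derive_coordB (b : 'rV[R]_N) i x :
  is_derive x (delta_mx ord0 i) (fun y => (y - b) ord0 i) 1.
Proof.
apply: is_derive_line (is_derive_quadratic ((x - b) ord0 i) 1 0) => k.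
by rewrite -addrA addr0 [k *: 1]mulr1 mxE !mxE !eqxx/=; ring.
Qed.

Lemma is_derive_dpot i x :
  is_derive x (delta_mx ord0 i) (dpot i) (n%:R * A i i).
Proof.
apply: is_derive_line (is_derive_quadratic (dpot i x) (n%:R * A i i) 0) => k.
rewrite addr0 [k *: 1]mulr1 /dpot.
rewrite (eq_bigr (fun j => ((x - a j) *m A) ord0 i + k * A i i)); last first.
  move=> j _; rewrite -addrA mulmxDl -scalemxAl -rowE.
  by rewrite mxE [X in X + _]mxE [X in _ * X]mxE addrC.
by rewrite big_split/= sumr_const card_ord -mulr_natl; ring.
Qed.

End Calculus.

(** * The drift field and the regularized single-pole inequality *)

Section Hardy.
Variable R : realType.

Lemma is_derive_fun_mul (V : normedModType R) (f g : V -> R) x v df dg :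
  is_derive x v f df -> is_derive x v g dg ->
  is_derive x v (fun y => f y * g y) (df * g x + f x * dg).
Proof.
move=> hf hg; have /is_derive_eq := is_deriveM hf hg; apply.
by rewrite addrC [_ *: df]mulrC.
Qed.

Lemma is_derive_fun_add (V : normedModType R) (f g : V -> R) x v df dg :
  is_derive x v f df -> is_derive x v g dg ->
  is_derive x v (fun y => f y + g y) (df + dg).
Proof. by move=> hf hg; exact: is_deriveD hf hg. Qed.

Lemma is_derive_fun_scale (V : normedModType R) (c : R) (f : V -> R) x v df :
  is_derive x v f df -> is_derive x v (fun y => c * f y) (c * df).
Proof. by move=> hf; have := is_deriveZ c hf. Qed.

Variables (N n : nat) (A : 'M[R]_N) (a : 'I_n -> 'rV[R]_N).
Hypothesis Asym : A^T = A.
Variables (b : 'rV[R]_N) (e : R).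
Hypothesis e0 : 0 < e.
Hypothesis N2 : (2 <= N)%N.

Let rho := gauss_unnorm A a.
Let V := @dpot R N n A a.
Let beta : R := (N%:R - 2) / 2.
Let D (x : 'rV[R]_N) : R := sqnorm (x - b) + e.

Let D_gt0 x : 0 < D x.
Proof. by rewrite ltr_wpDl// sqnorm_ge0. Qed.

(** The [i]-th component of the field [W]; [ddrift i] is its derivative in direction [i]. *)
Definition drift i (x : 'rV[R]_N) : R :=
  beta * ((x - b) ord0 i * (sqnorm (x - b) + e)^-1) + - (1/2) * V i x.

Definition ddrift (i : 'I_N) (x : 'rV[R]_N) : R :=
  beta * (1 / D x - 2 * (x - b) ord0 i ^+ 2 / D x ^+ 2) - (1/2) * (n%:R * A i i).

Lemma is_derive_drift i x :
  is_derive x (delta_mx ord0 i) (drift i) (ddrift i x).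
Proof.
have /is_derive_eq := is_derive_fun_add
  (is_derive_fun_scale beta (is_derive_fun_mul
     (is_derive_coordB b i x) (is_derive_inv_sqnorm b i x e0)))
  (is_derive_fun_scale (- (1/2)) (is_derive_dpot A a i x)).
apply; rewrite /ddrift -/(D x); field.
by rewrite gt_eqF// D_gt0.
Qed.

Lemma continuous_invD : continuous (fun x => (D x)^-1).
Proof.
apply: continuous_fun_inv; first by move=> x; rewrite gt_eqF// D_gt0.
apply: continuous_fun_add; first exact: continuous_sqnormB.
exact: continuous_fun_cst.
Qed.

Lemma continuous_drift i : continuous (drift i).
Proof.
apply: continuous_fun_add; apply: continuous_fun_mul;
  try exact: continuous_fun_cst; last exact: continuous_dpot.
by apply: continuous_fun_mul; [exact: continuous_coordB|exact: continuous_invD].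
Qed.

Lemma continuous_ddrift i : continuous (ddrift i).
Proof.
rewrite (_ : ddrift i = fun x => beta * ((D x)^-1 + - 2 *
  (((x - b) ord0 i * (D x)^-1) * ((x - b) ord0 i * (D x)^-1))) +
   - ((1/2) * (n%:R * A i i))); last first.
  apply/funext => x; rewrite /ddrift; field; by rewrite gt_eqF// D_gt0.
have cXD : continuous (fun x : 'rV[R]_N => (x - b) ord0 i * (D x)^-1).
  by apply: continuous_fun_mul; [exact: continuous_coordB|exact: continuous_invD].
apply: continuous_fun_add; last exact: continuous_fun_cst.
apply: continuous_fun_mul; first exact: continuous_fun_cst.
apply: continuous_fun_add; first exact: continuous_invD.
apply: continuous_fun_mul; first exact: continuous_fun_cst.
exact: continuous_fun_mul.
Qed.

Variables (M : R) (phi : 'rV[R]_N -> R) (p : 'I_N -> 'rV[R]_N -> R).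
Hypothesis dphi : forall i x, is_derive x (delta_mx ord0 i) phi (p i x).
Hypothesis cphi : continuous phi.
Hypothesis cp : forall i, continuous (p i).
Hypothesis phiM : box_supported M phi.

(** The [i]-th component of [phi^2 W rho]; summing [dflux i] over [i] gives its divergence. *)
Definition flux i x : R := phi x * phi x * (drift i x * rho x).

Definition dflux i x : R :=
  (p i x * phi x + phi x * p i x) * (drift i x * rho x) +
  phi x * phi x * (ddrift i x * rho x + drift i x * (- V i x * rho x)).

Lemma is_derive_flux i x : is_derive x (delta_mx ord0 i) (flux i) (dflux i x).
Proof.
apply: is_derive_fun_mul; apply: is_derive_fun_mul => //.
  exact: is_derive_drift.
exact: is_derive_gauss.
Qed.

Lemma continuous_dflux i : continuous (dflux i).
Proof.
have cr : continuous rho := @continuous_gauss R N n A a.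
have cV : continuous (V i) := @continuous_dpot R N n A a i.
have cw : continuous (drift i) := @continuous_drift i.
have cdw : continuous (ddrift i) := @continuous_ddrift i.
rewrite (_ : dflux i = fun x => (p i x * phi x + phi x * p i x) * (drift i x * rho x) +
  phi x * phi x * (ddrift i x * rho x + drift i x * ((-1) * V i x * rho x))).
  by repeat first [assumption|exact: cp|apply: continuous_fun_cst
    |apply: continuous_fun_add|apply: continuous_fun_mul].
by apply/funext => x; rewrite mulN1r.
Qed.

Lemma dflux_ge x :
  beta ^+ 2 * (phi x ^+ 2 / D x * rho x) <=
  (\sum_i p i x ^+ 2) * rho x + n%:R / 2 * \tr A * (phi x ^+ 2 * rho x)
  + \sum_i dflux i x.
Proof.
have D0 := D_gt0 x; have Dn0 : D x != 0 by rewrite gt_eqF.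
have r0 : 0 <= rho x by exact: expR_ge0.
have -> : (\sum_i p i x ^+ 2) * rho x + n%:R / 2 * \tr A * (phi x ^+ 2 * rho x)
  + \sum_i dflux i x =
  \sum_i (p i x ^+ 2 * rho x + n%:R / 2 * A i i * (phi x ^+ 2 * rho x) + dflux i x).
  by rewrite !big_split/= mulr_suml /mxtrace !mulr_sumr mulr_suml.
have le1 i : p i x ^+ 2 * rho x + n%:R / 2 * A i i * (phi x ^+ 2 * rho x) + dflux i x
  >= phi x ^+ 2 * rho x * (beta / D x) -
     phi x ^+ 2 * rho x * ((2 * beta + beta ^+ 2) / D x ^+ 2) * (x - b) ord0 i ^+ 2.
  rewrite -subr_ge0.
  (* Completing the square: the mixed term in [beta * V i x] produced by differentiating [rho]
     matches the one in [drift i x ^+ 2], and the trace term cancels the constant in [ddrift]. What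
     remains is a sum of two squares. *)
  have -> : p i x ^+ 2 * rho x + n%:R / 2 * A i i * (phi x ^+ 2 * rho x) + dflux i x
    - (phi x ^+ 2 * rho x * (beta / D x) -
     phi x ^+ 2 * rho x * ((2 * beta + beta ^+ 2) / D x ^+ 2) * (x - b) ord0 i ^+ 2)
    = rho x * ((p i x + phi x * drift i x) ^+ 2 + (phi x * V i x / 2) ^+ 2).
    by rewrite /dflux /ddrift /drift -/(D x); field.
  by rewrite mulr_ge0// addr_ge0// sqr_ge0.
apply: le_trans (ler_sum _ (fun i _ => le1 i)).
rewrite sumrB sumr_const card_ord -mulr_sumr -/(sqnorm (x - b)).
rewrite -subr_ge0.
(* Substituting [|x - b|^2 = D - e], the coefficient of [1 / D] is [N beta - 2 beta - 2 beta^2],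
   which is zero for [beta = (N - 2) / 2]. Only a nonnegative multiple of [e / D^2] is left. *)
have -> : phi x ^+ 2 * rho x * (beta / D x) *+ N -
  phi x ^+ 2 * rho x * ((2 * beta + beta ^+ 2) / D x ^+ 2) * sqnorm (x - b) -
  beta ^+ 2 * (phi x ^+ 2 / D x * rho x) =
  phi x ^+ 2 * rho x * ((2 * beta + beta ^+ 2) / D x ^+ 2) * e.
  rewrite -mulr_natl (_ : sqnorm (x - b) = D x - e); last by rewrite addrK.
  by rewrite /beta; field.
have b0 : 0 <= beta by rewrite divr_ge0// subr_ge0 ler_nat.
apply: mulr_ge0; last exact: ltW.
apply: mulr_ge0; first by rewrite mulr_ge0// sqr_ge0.
by rewrite divr_ge0 ?sqr_ge0// addr_ge0 ?sqr_ge0// mulr_ge0.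
Qed.

Lemma box_supportedM (f g : 'rV[R]_N -> R) :
  box_supported M f -> box_supported M (fun x => f x * g x).
Proof. by move=> fM x j Mx; rewrite (fM x j)// mul0r. Qed.

Variable l : {measure set RN R N -> \bar R}.
Hypothesis lM : (l (box M) < +oo)%E.
Hypothesis ldiv : div_free l.

Lemma hardy_supported :
  (\int[l]_x (beta ^+ 2 * (phi x ^+ 2 / D x * rho x))%:E <=
   \int[l]_x ((\sum_i p i x ^+ 2) * rho x +
              n%:R / 2 * \tr A * (phi x ^+ 2 * rho x))%:E)%E.
Proof.
have pM i := is_derive_box_supported (dphi i) phiM.
have fluxM i : box_supported M (flux i) by do 2 apply: box_supportedM.
have cr : continuous rho := @continuous_gauss R N n A a.
have dfi i : l.-integrable setT (EFin \o dflux i).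
  apply: continuous_supported_integrable lM _ _; first exact: continuous_dflux.
  exact: is_derive_box_supported (is_derive_flux i) (fluxM i).
have Gi : l.-integrable setT (fun x => ((\sum_i p i x ^+ 2) * rho x +
              n%:R / 2 * \tr A * (phi x ^+ 2 * rho x))%:E).
  apply: (@continuous_supported_integrable _ _ l _ M) => //.
    apply: continuous_fun_add; apply: continuous_fun_mul => //.
    - by apply: continuous_fun_sum => i; exact: continuous_fun_mul.
    - exact: continuous_fun_cst.
    - by apply: continuous_fun_mul => //; exact: continuous_fun_mul.
  move=> x j Mx; rewrite (phiM Mx) expr0n mul0r mulr0 addr0.
  by rewrite big1 ?mul0r// => i _; rewrite (pM i _ _ Mx) expr0n.
have Si : l.-integrable setT (fun x => \sum_i (dflux i x)%:E).
  by apply: integrable_sum => // i _; exact: dfi.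
(* The zero added on the right is the integral of the divergence, so the pointwise bound [dflux_ge]
   can be integrated. *)
rewrite -[leRHS]adde0.
have <- : (\int[l]_x (\sum_i (dflux i x)%:E) = 0)%E.
  rewrite integral_sum// big1// => i _.
  exact: ldiv (is_derive_flux i) (@continuous_dflux i) (fluxM i).
rewrite -integralD//; apply: le_integral => //.
- apply: (@continuous_supported_integrable _ _ l _ M) => //.
    apply: continuous_fun_mul; first exact: continuous_fun_cst.
    apply: continuous_fun_mul => //; apply: continuous_fun_mul.
      exact: continuous_fun_mul.
    exact: continuous_invD.
  by move=> x j Mx; rewrite (phiM Mx) expr0n !mul0r mulr0.
- exact: integrableD.
- by move=> x _; rewrite sumEFin -EFinD lee_fin; exact: dflux_ge.
Qed.

End Hardy.

(** * Passage to the limit *)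

Section WeightedIntegral.
Variables (R : realType) (d : measure_display) (T : measurableType d).
Variables (l : {measure set T -> \bar R}) (w : T -> R).
Hypothesis w0 : forall x, 0 <= w x.
Hypothesis mw : measurable_fun setT w.

Implicit Types f g : T -> R.

Definition wint (f : T -> R) : \bar R := (\int[l]_x (f x * w x)%:E)%E.

Lemma measurable_wint f : measurable_fun setT f ->
  measurable_fun setT (fun x => (f x * w x)%:E).
Proof. by move=> mf; apply/measurable_EFinP; exact: measurable_funM. Qed.

Lemma wint_ge0 f : (forall x, 0 <= f x) -> (0 <= wint f)%E.
Proof. by move=> f0; apply: integral_ge0 => x _; rewrite lee_fin mulr_ge0. Qed.

Lemma le_wint f g : (forall x, 0 <= f x) -> (forall x, f x <= g x) ->
  measurable_fun setT f -> measurable_fun setT g -> (wint f <= wint g)%E.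
Proof.
move=> f0 fg mf mg; apply: ge0_le_integral => //.
- by move=> x _; rewrite lee_fin mulr_ge0.
- exact: measurable_wint.
- exact: measurable_wint.
- by move=> x _; rewrite lee_fin ler_wpM2r.
Qed.

Lemma wint_lin (c e : R) f g : 0 <= c -> 0 <= e ->
  (forall x, 0 <= f x) -> (forall x, 0 <= g x) ->
  measurable_fun setT f -> measurable_fun setT g ->
  wint (fun x => c * f x + e * g x) = (c%:E * wint f + e%:E * wint g)%E.
Proof.
move=> c0 e0 f0 g0 mf mg; rewrite /wint.
have hf x : (0 <= (f x * w x)%:E)%E by rewrite lee_fin mulr_ge0.
have hg x : (0 <= (g x * w x)%:E)%E by rewrite lee_fin mulr_ge0.
rewrite -!ge0_integralZl_EFin//; try exact: measurable_wint.
rewrite -ge0_integralD//.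
- by apply: eq_integral => x _; rewrite -!EFinM -EFinD mulrDl !mulrA.
- by move=> x _; rewrite mule_ge0.
- by apply: measurable_funeM; exact: measurable_wint.
- by move=> x _; rewrite mule_ge0.
- by apply: measurable_funeM; exact: measurable_wint.
Qed.

Lemma wintZ (c : R) f : 0 <= c -> (forall x, 0 <= f x) ->
  measurable_fun setT f -> wint (fun x => c * f x) = (c%:E * wint f)%E.
Proof.
move=> c0 f0 mf; rewrite /wint -ge0_integralZl_EFin//.
- by apply: eq_integral => x _; rewrite -EFinM mulrA.
- by move=> x _; rewrite lee_fin mulr_ge0.
- exact: measurable_wint.
Qed.

End WeightedIntegral.

(** * From test functions to [H^1_mu], and from regularized to singular weights *)

Section Limit.
Variable R : realType.

Lemma compact_support_box N (f : 'rV[R]_N -> R) :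
  compact_support f -> exists M, box_supported M f.
Proof.
(* [(|r| + 1)^2] exceeds [r], so one coordinate beyond [|r| + 1] already puts [x] outside the ball
   of [compact_support]. *)
move=> [r fr]; exists (`|r| + 1) => x j rx; apply: fr.
apply: (@lt_le_trans _ _ (`|x ord0 j| ^+ 2)).
  have r0 : 0 <= `|r| by []; have := ler_norm r; nra.
rewrite real_normK ?num_real// /sqnorm (bigD1 j)//= lerDl sumr_ge0// => i _.
exact: sqr_ge0.
Qed.

(** Young's inequality for [x = y - (y - x)]; the gap is an explicit square divided by [t]. *)
Lemma peter_paul (t x y : R) : 0 < t ->
  x ^+ 2 <= (1 + t) * y ^+ 2 + (1 + t^-1) * (y - x) ^+ 2.
Proof.
move=> t0; rewrite -subr_ge0.
have -> : (1 + t) * y ^+ 2 + (1 + t^-1) * (y - x) ^+ 2 - x ^+ 2 =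
  t^-1 * (t * y + (y - x)) ^+ 2.
  by field; rewrite gt_eqF.
by rewrite mulr_ge0 ?sqr_ge0// invr_ge0 ltW.
Qed.

Lemma sqnorm_peter_paul N (t : R) (x y : 'rV[R]_N) : 0 < t ->
  sqnorm x <= (1 + t) * sqnorm y + (1 + t^-1) * sqnorm (y - x).
Proof.
move=> t0; rewrite /sqnorm !mulr_sumr -big_split/=; apply: ler_sum => i _.
by rewrite !mxE; exact: peter_paul.
Qed.

Lemma trace_pos_def_ge0 N (A : 'M[R]_N) : pos_def_sym A -> 0 <= \tr A.
Proof.
move=> [_ Apos]; apply: sumr_ge0 => i _; apply: ltW.
have := Apos (delta_mx ord0 i); rewrite /qform mulmx_delta_entry -rowE mxE; apply.
apply/eqP => /matrixP/(_ ord0 i); rewrite !mxE !eqxx => /eqP.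
by rewrite oner_eq0.
Qed.

(** The plain [1 / (q + 1/(m+1))] blows up at [q = 0], where [q^-1] is 0 by convention. The extra
    factor [q / (q + 1/(m+1))] makes the approximation vanish there, so it increases to [q^-1] at
    every [q >= 0] and the pole needs no null-set argument. *)
Definition inv_approx (q : R) (m : nat) : R := q / (q + m.+1%:R^-1) ^+ 2.

Let qm_gt0 (q : R) m : 0 <= q -> 0 < q + m.+1%:R^-1.
Proof. by move=> q0; rewrite ltr_wpDl// invr_gt0. Qed.

Lemma inv_approx_ge0 q m : 0 <= q -> 0 <= inv_approx q m.
Proof. by move=> q0; rewrite divr_ge0// sqr_ge0. Qed.

Lemma inv_approx_le q m : 0 <= q -> inv_approx q m <= (q + m.+1%:R^-1)^-1.
Proof.
move=> q0; have qm := qm_gt0 m q0.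
rewrite /inv_approx expr2 invfM mulrA ler_piMl ?invr_ge0 ?(ltW qm)//.
by rewrite ler_pdivrMr// mul1r lerDl invr_ge0.
Qed.

Lemma inv_approx_nd q m m' : 0 <= q -> (m <= m')%N ->
  inv_approx q m <= inv_approx q m'.
Proof.
move=> q0 mm'; rewrite ler_wpM2l// lef_pV2 ?posrE ?exprn_gt0 ?qm_gt0//.
rewrite lerXn2r ?nnegrE ?(ltW (qm_gt0 _ q0))// lerD2l lef_pV2 ?posrE//.
by rewrite ler_nat.
Qed.

(* With the convention 0^-1 = 0 the limit is also right at q = 0. *)
Lemma inv_approx_cvg q : 0 <= q -> inv_approx q @ \oo --> q^-1.
Proof.
rewrite le_eqVlt => /orP[/eqP <-|q0].
  rewrite invr0; apply: cvg_near_cst; near=> m; by rewrite /inv_approx mul0r.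
have -> : q^-1 = q * ((q + 0) ^+ 2)^-1.
  by rewrite addr0; field; rewrite gt_eqF.
apply: cvgMr; apply: cvgV; first by rewrite addr0 expf_neq0// gt_eqF.
apply: (@cvgM _ _ _ _ (fun m => q + m.+1%:R^-1) (fun m => q + m.+1%:R^-1)).
  by apply: cvgD; [exact: cvg_cst|exact: cvg_harmonic].
by apply: cvgD; [exact: cvg_cst|exact: cvg_harmonic].
Unshelve. all: by end_near. Qed.

Lemma measurable_inv_approx N (b : 'rV[R]_N) m : measurable_fun setT
  (fun x : RN R N => inv_approx (sqnorm ((x : 'rV_N) - b)) m).
Proof.
apply: continuous_borel; apply: continuous_fun_mul.
  exact: continuous_sqnormB.
apply: continuous_fun_inv => [x|].
  by rewrite expf_neq0// gt_eqF// qm_gt0// sqnorm_ge0.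
have cq : continuous (fun x : 'rV[R]_N => sqnorm (x - b) + m.+1%:R^-1).
  by apply: continuous_fun_add; [exact: continuous_sqnormB|exact: continuous_fun_cst].
exact: (continuous_fun_mul cq cq).
Qed.

(** The function is discontinuous at [b], but it is a pointwise limit of continuous ones. *)
Lemma measurable_inv_sqnorm N (b : 'rV[R]_N) : measurable_fun setT
  (fun x : RN R N => (sqnorm ((x : 'rV_N) - b))^-1).
Proof.
apply: (measurable_fun_cvg (fun m => @measurable_inv_approx N b m)) => x _.
exact/inv_approx_cvg/sqnorm_ge0.
Qed.

Variables (N n : nat) (A : 'M[R]_N) (a : 'I_n -> 'rV[R]_N).
Hypothesis N2 : (2 <= N)%N.
Hypothesis Apos : pos_def_sym A.
Variables (phi : 'rV[R]_N -> R) (g : 'rV[R]_N -> 'rV[R]_N).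
Variable l : {measure set RN R N -> \bar R}.
Hypothesis lM : forall M, (l (box M) < +oo)%E.
Hypothesis ldiv : div_free l.
Hypothesis mphi : borel_fun phi.
Hypothesis mg : forall j : 'I_N, borel_fun (fun x => g x ord0 j).
Variable c : R.
Hypothesis c0 : 0 <= c.

Let w (x : RN R N) : R := c * gauss_unnorm A a x.
Let beta : R := (N%:R - 2) / 2.
Let K : R := n%:R / 2 * \tr A.
Let I (f : 'rV[R]_N -> R) : \bar R := wint l w f.

Let K0 : 0 <= K.
Proof. by rewrite mulr_ge0 ?divr_ge0//; exact: trace_pos_def_ge0. Qed.

Let w0 x : 0 <= w x.
Proof. by rewrite mulr_ge0// expR_ge0. Qed.

Let mw : measurable_fun setT w.
Proof.
apply: measurable_funM; first exact: measurable_cst.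
by apply: continuous_borel; exact: continuous_gauss.
Qed.

Let invD_continuous (b : 'rV[R]_N) (e : R) : 0 < e ->
  continuous (fun x : 'rV[R]_N => (sqnorm (x - b) + e)^-1).
Proof. exact: continuous_invD. Qed.

Lemma hardy_smooth (b : 'rV[R]_N) (e : R) (u : 'rV[R]_N -> R) : 0 < e ->
  Cc_infty u ->
  (I (fun x => beta ^+ 2 * (u x ^+ 2 / (sqnorm (x - b) + e)))%R <=
   I (fun x => sqnorm (grad u x) + K * u x ^+ 2)%R)%E.
Proof.
move=> e0 [su /compact_support_box[M uM]].
have [ud uc] := su 1%N.
have du i x : is_derive x (delta_mx ord0 i) u (partial i u x).
  by apply: derivableP; exact: diff_derivable.
have cu : continuous u by move=> x; exact: differentiable_continuous.
have := @hardy_supported R N n A a Apos.1 b e e0 N2 M u (fun i => partial i u)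
  du cu uc uM l (lM M) ldiv.
rewrite -/beta -/K.
have mu : measurable_fun setT (u : RN R N -> R) by exact: continuous_borel.
have mr : measurable_fun setT (gauss_unnorm A a : RN R N -> R).
  by apply: continuous_borel; exact: continuous_gauss.
have mG : measurable_fun setT (fun x : RN R N => \sum_i partial i u x ^+ 2).
  by apply: measurable_sum => i; apply: measurable_funX; exact: continuous_borel.
have gE x : sqnorm (grad u x) = \sum_i partial i u x ^+ 2.
  by apply: eq_bigr => i _; rewrite mxE.
have r0 x : 0 <= gauss_unnorm A a x by exact: expR_ge0.
(* Multiplying both sides by [c] turns the weight [rho] into [w]. *)
move=> H; have : (0 <= c%:E)%E by rewrite lee_fin.
move=> /lee_wpmul2l/(_ _ _ H); rewrite -!ge0_integralZl_EFin//.
- rewrite (eq_integral (fun x : RN R N => (beta ^+ 2 *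
    (u x ^+ 2 / (sqnorm ((x : 'rV_N) - b) + e)) * w x)%:E)); last first.
    by move=> x _; rewrite -EFinM /w; congr EFin; ring.
  rewrite [leRHS](eq_integral (fun x : RN R N =>
    ((sqnorm (grad u x) + K * u x ^+ 2) * w x)%:E))//.
  by move=> x _; rewrite -EFinM gE /w; congr EFin; ring.
- move=> x _; rewrite lee_fin addr_ge0//.
    by rewrite mulr_ge0// sumr_ge0// => i _; rewrite sqr_ge0.
  by rewrite mulr_ge0// mulr_ge0// sqr_ge0.
- apply/measurable_EFinP; apply: measurable_funD; first exact: measurable_funM.
  apply: measurable_funM; first exact: measurable_cst.
  by apply: measurable_funM => //; exact: measurable_funX.
- move=> x _; rewrite lee_fin mulr_ge0 ?sqr_ge0// mulr_ge0// divr_ge0 ?sqr_ge0//.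
  by rewrite addr_ge0 ?sqnorm_ge0// ltW.
- apply/measurable_EFinP; apply: measurable_funM; first exact: measurable_cst.
  apply: measurable_funM => //; apply: measurable_funM; first exact: measurable_funX.
  by apply: continuous_borel; exact: invD_continuous.
Qed.

Let mphi' : measurable_fun setT (phi : RN R N -> R).
Proof. exact: borel_fun_measurable. Qed.

Lemma measurable_sqnorm (G : 'rV[R]_N -> 'rV[R]_N) :
  (forall j, measurable_fun setT (fun x : RN R N => G x ord0 j)) ->
  measurable_fun setT (fun x : RN R N => sqnorm (G x)).
Proof.
move=> mG; rewrite /sqnorm.
apply: (measurable_sum _ (h := fun j (x : RN R N) => G x ord0 j ^+ 2)) => j.
exact: (measurable_funX _ (mG j)).
Qed.

Let energy : \bar R := I (fun x => sqnorm (g x) + K * phi x ^+ 2).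

(** Peter-Paul is used twice, from [phi] to [u] on the left and from [u] back to [phi] on the right.
    Hence the factor [(1 + t)^2] on [energy]; every other term is a multiple of a distance between
    [u] and [phi] or between their gradients. *)
Lemma hardy_step (b : 'rV[R]_N) (e t : R) (u : 'rV[R]_N -> R) : 0 < e -> 0 < t ->
  Cc_infty u ->
  (I (fun x => beta ^+ 2 * (phi x ^+ 2 / (sqnorm (x - b) + e)))%R <=
   (1 + t)%:E * ((1 + t)%:E * energy + (1 + t^-1)%:E *
     (1%:E * I (fun x => sqnorm (grad u x - g x))%R +
      K%:E * I (fun x => (u x - phi x) ^+ 2)%R))
   + ((1 + t^-1) * (beta ^+ 2 / e))%:E * I (fun x => (u x - phi x) ^+ 2)%R)%E.
Proof.
move=> e0 t0 uC.
have [ud cgu] := uC.1 1%N.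
have cu : continuous u by move=> x; exact: differentiable_continuous.
have mu : measurable_fun setT (u : RN R N -> R) by exact: continuous_borel.
have mgr j : measurable_fun setT (fun x : RN R N => grad u x ord0 j).
  rewrite (_ : (fun x => _) = partial j u); first exact: continuous_borel.
  by apply/funext => x; rewrite mxE.
have mg' j : measurable_fun setT (fun x : RN R N => g x ord0 j).
  exact: borel_fun_measurable.
have mgg : measurable_fun setT (fun x : RN R N => sqnorm (grad u x - g x)).
  apply: measurable_sqnorm => j.
  rewrite (_ : (fun x => _) = fun x => grad u x ord0 j - g x ord0 j).
    exact: measurable_funB.
  by apply/funext => x; rewrite mxE [X in _ + X]mxE.
have t1 : 0 <= 1 + t by rewrite addr_ge0// ltW.
have ti1 : 0 <= 1 + t^-1 by rewrite addr_ge0// invr_ge0 ltW.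
have mD : measurable_fun setT
    (fun x : RN R N => (sqnorm ((x : 'rV_N) - b) + e)^-1).
  by apply: continuous_borel; exact: invD_continuous.
have D0 x : 0 < sqnorm (x - b) + e by rewrite ltr_wpDl// sqnorm_ge0.
have mH (f : 'rV[R]_N -> R) : measurable_fun setT (f : RN R N -> R) ->
  measurable_fun setT (fun x : RN R N =>
    beta ^+ 2 * (f x ^+ 2 / (sqnorm ((x : 'rV_N) - b) + e))).
  move=> mf; apply: measurable_funM; first exact: measurable_cst.
  by apply: measurable_funM => //; exact: measurable_funX.
have mE (G : 'rV[R]_N -> 'rV[R]_N) (f : 'rV[R]_N -> R) :
  (forall j, measurable_fun setT (fun x : RN R N => G x ord0 j)) ->
  measurable_fun setT (f : RN R N -> R) ->
  measurable_fun setT (fun x : RN R N => sqnorm (G x) + K * f x ^+ 2).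
  move=> mG mf; apply: measurable_funD; first exact: measurable_sqnorm.
  by apply: measurable_funM; [exact: measurable_cst|exact: measurable_funX].
have mdf : measurable_fun setT (fun x : RN R N => (u x - phi x) ^+ 2).
  by apply: measurable_funX; exact: measurable_funB.
have mlin (c1 c2 : R) (f1 f2 : RN R N -> R) : measurable_fun setT f1 ->
  measurable_fun setT f2 -> measurable_fun setT (fun x => c1 * f1 x + c2 * f2 x).
  move=> m1 m2; apply: measurable_funD; apply: measurable_funM => //;
    exact: measurable_cst.
have H0 (f : 'rV[R]_N -> R) x :
    0 <= beta ^+ 2 * (f x ^+ 2 / (sqnorm (x - b) + e)).
  by rewrite mulr_ge0 ?sqr_ge0// divr_ge0 ?sqr_ge0// ltW.
have E0 (G : 'rV[R]_N -> 'rV[R]_N) (f : 'rV[R]_N -> R) x :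
    0 <= sqnorm (G x) + K * f x ^+ 2.
  by rewrite addr_ge0 ?sqnorm_ge0// mulr_ge0 ?sqr_ge0.
have S1 : (I (fun x => beta ^+ 2 * (phi x ^+ 2 / (sqnorm (x - b) + e)))%R <=
    (1 + t)%:E * I (fun x => beta ^+ 2 * (u x ^+ 2 / (sqnorm (x - b) + e)))%R +
    ((1 + t^-1) * (beta ^+ 2 / e))%:E * I (fun x => (u x - phi x) ^+ 2)%R)%E.
  have k0 : 0 <= (1 + t^-1) * (beta ^+ 2 / e).
    by rewrite mulr_ge0// divr_ge0 ?sqr_ge0// ltW.
  have d0 (x : RN R N) : 0 <= (u x - phi x) ^+ 2 by exact: sqr_ge0.
  rewrite /I -(wint_lin l w0 mw t1 k0 (H0 u) d0 (mH u mu) mdf).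
  apply: (le_wint l w0 mw).
  - by move=> x; exact: H0.
  - move=> x; set q := sqnorm _ + e.
    have q0 : 0 < q by exact: D0.
    have := peter_paul (phi x) (u x) t0 => pp.
    apply: (@le_trans _ _ (beta ^+ 2 * (((1 + t) * u x ^+ 2 +
        (1 + t^-1) * (u x - phi x) ^+ 2) / q))).
      by rewrite ler_wpM2l ?sqr_ge0// ler_wpM2r// invr_ge0 ltW.
    rewrite [leLHS](_ : _ = (1 + t) * (beta ^+ 2 * (u x ^+ 2 / q)) +
      beta ^+ 2 * ((1 + t^-1) * (u x - phi x) ^+ 2 / q)); last by ring.
    (* The weight is at most [1 / e], so the error is controlled by the unweighted distance of [u]
       to [phi]. *)
    rewrite lerD2l [leRHS](_ : _ =
      beta ^+ 2 * ((1 + t^-1) * (u x - phi x) ^+ 2 / e)); last by ring.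
    apply: ler_wpM2l; first exact: sqr_ge0.
    apply: ler_wpM2l; first by rewrite mulr_ge0// sqr_ge0.
    rewrite lef_pV2 ?posrE//.
    by rewrite lerDr sqnorm_ge0.
  - exact: mH.
  - by apply: mlin => //; exact: mH.
have S2 : (I (fun x => sqnorm (grad u x) + K * u x ^+ 2)%R <=
    (1 + t)%:E * energy + (1 + t^-1)%:E *
     (1%:E * I (fun x => sqnorm (grad u x - g x))%R +
      K%:E * I (fun x => (u x - phi x) ^+ 2)%R))%E.
  have s0 (x : RN R N) : 0 <= sqnorm (grad u x - g x) by exact: sqnorm_ge0.
  have d0 (x : RN R N) : 0 <= (u x - phi x) ^+ 2 by exact: sqr_ge0.
  have sd0 (x : RN R N) :
      0 <= 1 * sqnorm (grad u x - g x) + K * (u x - phi x) ^+ 2.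
    by rewrite mul1r addr_ge0// mulr_ge0.
  rewrite /energy /I -(wint_lin l w0 mw ler01 K0 s0 d0 mgg mdf).
  rewrite -(wint_lin l w0 mw t1 ti1 (E0 g phi) sd0 (mE _ _ mg' mphi')); last first.
    exact: mlin.
  apply: (le_wint l w0 mw).
  - by move=> x; exact: E0.
  - move=> x; rewrite mul1r.
    have pp := peter_paul (u x) (phi x) t0.
    have pq := sqnorm_peter_paul (grad u x) (g x) t0.
    have sqC : (u x - phi x) ^+ 2 = (phi x - u x) ^+ 2 by ring.
    have sqnC : sqnorm (grad u x - g x) = sqnorm (g x - grad u x).
      by apply: eq_bigr => j _; rewrite !mxE; ring.
    rewrite sqC sqnC; apply: le_trans (lerD pq (ler_wpM2l K0 pp)) _.
    by rewrite le_eqVlt; apply/orP; left; apply/eqP; ring.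
  - exact: mE.
  - by apply: (mlin _ _ _ _ (mE _ _ mg' mphi')); exact: mlin.
apply: (le_trans S1); apply: leeD => //.
apply: lee_wpmul2l; first by rewrite lee_fin.
exact: le_trans (hardy_smooth b e0 uC) S2.
Qed.

Variable u : nat -> 'rV[R]_N -> R.
Hypothesis uC : forall k, Cc_infty (u k).
Hypothesis uphi : (fun k => I (fun x => (u k x - phi x) ^+ 2)) @ \oo --> 0%E.
Hypothesis ug : (fun k => I (fun x => sqnorm (grad (u k) x - g x))) @ \oo --> 0%E.

Lemma energy_ge0 : (0 <= energy)%E.
Proof.
apply: wint_ge0 => // x.
by rewrite addr_ge0 ?sqnorm_ge0// mulr_ge0 ?sqr_ge0.
Qed.

(** For fixed [t], letting [k] tend to infinity in [hardy_step] leaves [(1 + t)^2 * energy]; then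
    [t] is removed by showing [r * X <= E] for every [r] in [(0, 1)]. *)
Lemma hardy_regularized (b : 'rV[R]_N) (e : R) : 0 < e ->
  (I (fun x => beta ^+ 2 * (phi x ^+ 2 / (sqnorm (x - b) + e)))%R <= energy)%E.
Proof.
move=> e0; apply/lee_mul01Pr.
  apply: wint_ge0 => // x; rewrite mulr_ge0 ?sqr_ge0// divr_ge0 ?sqr_ge0//.
  by rewrite addr_ge0 ?sqnorm_ge0// ltW.
move=> r /andP[r0 r1]; have := energy_ge0; set E := energy => E0.
(* An infinite energy makes the bound trivial; otherwise the rest is real arithmetic. *)
have [->|Efin] := eqVneq E +oo%E; first exact: leey.
have {Efin} Ef : E \is a fin_num by rewrite ge0_fin_numE// lt_neqAle Efin leey.
(* With [r = 1 - 2 t], [1 - r (1 + t)^2 = t^2 (3 + 2 t)] is nonnegative. *)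
pose t := (1 - r) / 2.
have t0 : 0 < t by rewrite divr_gt0// subr_gt0.
have step k := hardy_step b e0 t0 (uC k).
set X := I _.
have cv : ((1 + t)%:E * ((1 + t)%:E * E + (1 + t^-1)%:E *
     (1%:E * I (fun x => sqnorm (grad (u k) x - g x))%R +
      K%:E * I (fun x => (u k x - phi x) ^+ 2)%R))
   + ((1 + t^-1) * (beta ^+ 2 / e))%:E * I (fun x => (u k x - phi x) ^+ 2)%R)%E
   @[k --> \oo] -->
   ((1 + t)%:E * ((1 + t)%:E * E + (1 + t^-1)%:E * (1%:E * 0 + K%:E * 0)) +
    ((1 + t^-1) * (beta ^+ 2 / e))%:E * 0)%E.
  apply: cvgeD; first by rewrite mule0 fin_num_adde_defl.
  - apply: cvgeZl => //; apply: cvgeD.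
    + by rewrite !mule0 adde0 mule0 fin_num_adde_defl.
    + exact: cvg_cst.
    + apply: cvgeZl => //; apply: cvgeD; first by rewrite !mule0.
        exact: cvgeZl.
      exact: cvgeZl.
  - exact: cvgeZl.
have : (X <= (1 + t)%:E * ((1 + t)%:E * E))%E.
  move: cv; rewrite !mule0 !adde0 mule0 !adde0 => cv.
  rewrite -(cvg_lim _ cv)//; apply: lime_ge; first by apply/cvg_ex; eexists; exact: cv.
  by near=> k; exact: step.
rewrite -(fineK Ef) -!EFinM => XE.
have r0' : (0 <= r%:E)%E by rewrite lee_fin ltW.
apply: (le_trans (lee_wpmul2l r0' XE)); rewrite -EFinM lee_fin.
have x0 : 0 <= fine E by exact: fine_ge0.
have -> : r = 1 - 2 * t by rewrite /t; field.
rewrite -subr_ge0.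
have -> : fine E - (1 - 2 * t) * ((1 + t) * ((1 + t) * fine E)) =
  fine E * (t ^+ 2 * (3 + 2 * t)) by ring.
by rewrite mulr_ge0// mulr_ge0 ?sqr_ge0// addr_ge0// mulr_ge0// ltW.
Unshelve. all: by end_near. Qed.

(** Monotone convergence along [inv_approx]: its [m]-th term lies below the regularized weight with
    [e = 1/(m+1)], whose integral is bounded by [energy] uniformly in [m]. *)
Lemma hardy_pole (b : 'rV[R]_N) :
  (I (fun x => beta ^+ 2 * (phi x ^+ 2 / sqnorm (x - b)))%R <= energy)%E.
Proof.
pose h m (x : RN R N) : R :=
  beta ^+ 2 * (phi x ^+ 2 * inv_approx (sqnorm ((x : 'rV_N) - b)) m).
have q0 (x : 'rV[R]_N) : 0 <= sqnorm (x - b) by exact: sqnorm_ge0.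
have h0 m x : 0 <= h m x.
  by rewrite mulr_ge0 ?sqr_ge0// mulr_ge0 ?sqr_ge0// inv_approx_ge0.
have mh m : measurable_fun setT (h m).
  apply: measurable_funM; first exact: measurable_cst.
  apply: measurable_funM; first exact: measurable_funX.
  exact: measurable_inv_approx.
have nd x m m' : (m <= m')%N -> ((h m x * w x)%:E <= (h m' x * w x)%:E)%E.
  move=> mm'; rewrite lee_fin ler_wpM2r// ler_wpM2l ?sqr_ge0//.
  by rewrite ler_wpM2l ?sqr_ge0// inv_approx_nd.
have hw0 m (x : RN R N) : setT x -> (0 <= (h m x * w x)%:E)%E.
  by move=> _; rewrite lee_fin mulr_ge0.
have mhw m := measurable_wint mw (mh m).
have cvh x : (h m x * w x)%:E @[m --> \oo] -->
    (beta ^+ 2 * (phi x ^+ 2 / sqnorm ((x : 'rV_N) - b)) * w x)%:E.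
  apply: cvg_EFin; first by near=> m.
  apply: cvgMl; apply: cvgMr; apply: cvgMr.
  exact: inv_approx_cvg.
have -> : I (fun x => beta ^+ 2 * (phi x ^+ 2 / sqnorm (x - b))) =
    limn (fun m => \int[l]_x (h m x * w x)%:E)%E.
  rewrite -(monotone_convergence l measurableT mhw hw0); last first.
    by move=> x _ m m'; exact: nd.
  by apply: eq_integral => x _; apply/esym/cvg_lim => //; exact: cvh.
apply: lime_le.
  apply: ereal_nondecreasing_is_cvgn => m m' mm'.
  apply: ge0_le_integral => //; last by move=> x _; exact: nd.
  by move=> x; exact: hw0.
near=> m; apply: le_trans (@hardy_regularized b m.+1%:R^-1 _); last first.
  by rewrite invr_gt0.
apply: le_wint => //.
  move=> x; rewrite ler_wpM2l ?sqr_ge0// ler_wpM2l ?sqr_ge0//.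
  exact: inv_approx_le.
apply: measurable_funM; first exact: measurable_cst.
apply: measurable_funM; first exact: measurable_funX.
by apply: continuous_borel; apply: invD_continuous; rewrite invr_gt0.
Unshelve. all: by end_near. Qed.

Lemma hardy_multipole : (0 < n)%N ->
  ((beta ^+ 2 / n%:R)%:E * I (fun x => \sum_(i < n) phi x ^+ 2 / sqnorm (x - a i))%R
   <= energy)%E.
Proof.
move=> n0.
have nR0 : 0 <= n%:R^-1 :> R by rewrite invr_ge0.
have f0 i x : 0 <= phi x ^+ 2 / sqnorm (x - a i).
  by rewrite divr_ge0 ?sqr_ge0// sqnorm_ge0.
have mf i : measurable_fun setT
    (fun x : RN R N => phi x ^+ 2 / sqnorm ((x : 'rV_N) - a i)).
  apply: measurable_funM; first exact: measurable_funX.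
  exact: measurable_inv_sqnorm.
have b0 : 0 <= beta ^+ 2 by exact: sqr_ge0.
have IE : I (fun x => \sum_(i < n) phi x ^+ 2 / sqnorm (x - a i)) =
    (\sum_(i < n) I (fun x => phi x ^+ 2 / sqnorm (x - a i))%R)%E.
  rewrite /I /wint -ge0_integral_sum//.
  - by apply: eq_integral => x _; rewrite mulr_suml sumEFin.
  - by move=> i; exact: measurable_wint.
  - by move=> i x _; rewrite lee_fin mulr_ge0.
rewrite IE ge0_sume_distrr; last by move=> i _; exact: wint_ge0.
(* The energy is split into [n] equal shares, each bounding [1/n] times the contribution of one
   pole. *)
apply: (@le_trans _ _ (\sum_(i < n) ((n%:R^-1)%:E * energy))%E).
  apply: lee_sum => i _; rewrite mulrC EFinM -muleA.
  apply: lee_wpmul2l; first by rewrite lee_fin.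
  rewrite -wintZ//; exact: hardy_pole.
rewrite -ge0_sume_distrl//.
rewrite sumEFin sumr_const card_ord -[_^-1 *+ n]mulr_natr mulVf ?mul1e//.
by rewrite pnatr_eq0 -lt0n.
Qed.

End Limit.

(** * Return to the iterated integral and the normalized density *)

Theorem theorem3p2 (R : realType) (N n : nat) (a : 'I_n -> 'rV[R]_N)
    (A : 'M[R]_N) (phi : 'rV[R]_N -> R) (g : 'rV[R]_N -> 'rV[R]_N) :
  (3 <= N)%N -> (1 <= n)%N -> pos_def_sym A ->
  H1mu_with_grad A a phi g ->
  ((((N%:R - 2) / 2) ^+ 2 / n%:R)%:E *
     intRN (fun x => ((\sum_(i < n) phi x ^+ 2 / sqnorm (x - a i)) * mu_dens A a x)%:E)
   <= intRN (fun x => (sqnorm (g x) * mu_dens A a x)%:E)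
      + (n%:R / 2 * \tr A)%:E * intRN (fun x => (phi x ^+ 2 * mu_dens A a x)%:E))%E.
Proof.
move=> N3 n1 Apos [mphi [mg [u [uC [uphi ug]]]]].
have [l [lE lM ldiv]] := lebesgue_RN R N.
have mr : measurable_fun setT (gauss_unnorm A a : RN R N -> R).
  by apply: continuous_borel; exact: continuous_gauss.
(* An infinite Gaussian integral would give [c = 0], so only [0 <= c] is needed. *)
pose c := (fine (intRN (fun y => (gauss_unnorm A a y)%:E)))^-1.
have c0 : 0 <= c.
  rewrite invr_ge0 fine_ge0// lE.
  - by apply: integral_ge0 => x _; rewrite lee_fin expR_ge0.
  - exact/measurable_EFinP.
  - by move=> x; rewrite lee_fin expR_ge0.
pose w (x : RN R N) : R := c * gauss_unnorm A a x.
have w0 x : 0 <= w x by rewrite mulr_ge0// expR_ge0.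
have mw : measurable_fun setT w.
  by apply: measurable_funM => //; exact: measurable_cst.
(* Identifying the iterated integral with a measure integral requires a measurable nonnegative
   integrand; the measurability facts below supply this for each integral involved. *)
have IE (f : 'rV[R]_N -> R) : measurable_fun setT (f : RN R N -> R) ->
    (forall x, 0 <= f x) ->
    intRN (fun x => (f x * mu_dens A a x)%:E) = wint l w f.
  move=> mf f0; have -> : mu_dens A a = w.
    by apply/funext => x; rewrite /mu_dens mulrC.
  rewrite lE//; first exact: measurable_wint.
  by move=> x; rewrite lee_fin mulr_ge0.
have mphi' := borel_fun_measurable mphi.
have mg' j := borel_fun_measurable (mg j).
have mphi2 : measurable_fun setT (fun x : RN R N => phi x ^+ 2).
  exact: measurable_funX.
have mgr k j : measurable_fun setT (fun x : RN R N => grad (u k) x ord0 j).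
  rewrite (_ : (fun x => _) = partial j (u k)); last first.
    by apply/funext => x; rewrite mxE.
  by apply: continuous_borel; have [_] := (uC k).1 1%N.
have mu k : measurable_fun setT (u k : RN R N -> R).
  by apply: continuous_borel; exact: ((uC k).1 0%N).
have phi0 x : 0 <= phi x ^+ 2 by exact: sqr_ge0.
have g0 x : 0 <= sqnorm (g x) by exact: sqnorm_ge0.
have msg : measurable_fun setT (fun x : RN R N => sqnorm (g x)).
  exact: measurable_sqnorm.
rewrite !IE//; last 2 first.
- apply: (measurable_sum _ (h := fun i (x : RN R N) =>
    phi x ^+ 2 / sqnorm ((x : 'rV_N) - a i))) => i.
  by apply: measurable_funM => //; exact: measurable_inv_sqnorm.
- by move=> x; apply: sumr_ge0 => i _; rewrite divr_ge0// sqnorm_ge0.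
have K0 : 0 <= n%:R / 2 * \tr A.
  by rewrite mulr_ge0 ?divr_ge0//; exact: trace_pos_def_ge0.
(* The two integrals on the right merge into the single energy integral of [hardy_multipole]. *)
rewrite -[wint l w (fun x => sqnorm (g x))]mul1e -wint_lin//.
under [X in (_ <= wint _ _ X)%E]eq_fun do rewrite mul1r.
apply: (@hardy_multipole R N n A a (ltnW N3) Apos phi g l lM ldiv mphi mg c c0 u uC) => //.
- rewrite (_ : (fun k => _) =
    fun k => intRN (fun x => ((u k x - phi x) ^+ 2 * mu_dens A a x)%:E))//.
  apply/funext => k; rewrite IE//; last by move=> x; exact: sqr_ge0.
  by apply: measurable_funX; exact: measurable_funB.
- rewrite (_ : (fun k => _) =
    fun k => intRN (fun x => (sqnorm (grad (u k) x - g x) * mu_dens A a x)%:E))//.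
  apply/funext => k; rewrite IE//; last by move=> x; exact: sqnorm_ge0.
  apply: measurable_sqnorm => j.
  rewrite (_ : (fun x => _) = fun x => grad (u k) x ord0 j - g x ord0 j).
    exact: measurable_funB.
  by apply/funext => x; rewrite mxE [X in _ + X]mxE.
Qed.
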